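(* Let $X$, $Y$ be Banach spaces, $G \subset X$ an open set and $f:G \to Y$ an arbitrary mapping. Let $V_1$ be a subspace of $X$ such that the space $\mathcal{L}(V_1,Y)$ is separable. Then there exists a $\sigma$-porous set $A \subset G$ such that, for each $x \in G \setminus A$, the following assertion holds: if $f$ is Lipschitz at $x$, and is Fréchet differentiable at $x$ along $V_1$ and along some topological complement $V_2^x$ of $V_1$, then $f$ is Fréchet differentiable at $x$.
   Context: All Banach spaces are real and nontrivial ($\neq\{0\}$), with norm denoted $|\cdot|$. A subspace of a Banach space means a closed linear subspace $\neq\{0\}$. $\mathcal{L}(V_1,Y)$ is the Banach space of continuous linear mappings $V_1\to Y$ with the operator norm. A topological complement of $V_1$ in $X$ is a subspace $V_2$ such that $X$ is the topological direct sum $V_1\oplus V_2$. $B(x,r)$ is the open ball. For a subspace $V$ of $X$, $f$ is Fréchet differentiable at $x\in G$ along $V$ if the mapping $g(v):=f(x+v)$, $v\in V\cap(G-x)$, is Fréchet differentiable at $0\in V$. $f$ is Lipschitz at $x\in G$ if $\limsup_{y\to x}\frac{|f(y)-f(x)|}{|y-x|}<\infty$. A set $A\subset X$ is porous at $x\in X$ if there exists $c>0$ such that for each $\delta>0$ there exists $t\in B(x,\delta)\setminus\{x\}$ with $B(t,c|t-x|)\cap A=\emptyset$. $A$ is porous if it is porous at each of its points, and $\sigma$-porous if it is a countable union of porous sets. *)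

(* Defs.v *)
From HB Require Import structures.
From mathcomp Require Import all_boot all_order all_algebra.
From mathcomp Require Import all_classical all_reals all_analysis.

Set Implicit Arguments.
Unset Strict Implicit.
Unset Printing Implicit Defensive.

Import Order.TTheory GRing.Theory Num.Theory.
Import numFieldNormedType.Exports.

Local Open Scope classical_set_scope.
Local Open Scope ring_scope.

Section ClosedSubspace.
Context {R : realType} {X : normedModType R}.

Record closedSubspace := ClosedSubspace {
  cspace_set : set X;
  cspace_submod : submod_closed [pred x | x \in cspace_set];
  cspace_closed : closed cspace_set;
  cspace_nontrivial : exists2 x, cspace_set x & x != 0 }.

Definition cspace_pred (V : closedSubspace) : {pred X} :=
  [pred x | x \in cspace_set V].

HB.instance Definition _ (V : closedSubspace) :=
  GRing.isSubmodClosed.Build R X (cspace_pred V) (cspace_submod V).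

(* A separate carrier rather than the sigma type of [cspace_set V]: the latter
   already has a library topology, which the norm below would duplicate. *)
Record cspace (V : closedSubspace) := Cspace {
  cspace_val : X;
  cspace_valP : cspace_val \in cspace_pred V }.

HB.instance Definition _ (V : closedSubspace) :=
  [isSub for @cspace_val V].
HB.instance Definition _ (V : closedSubspace) :=
  [Choice of cspace V by <:].
HB.instance Definition _ (V : closedSubspace) :=
  [SubChoice_isSubLmodule of cspace V by <:].

Section Norm.
Variable V : closedSubspace.

Definition cspace_norm (v : cspace V) : R := `|cspace_val v|.

Let cspace_normD (u v : cspace V) :
  cspace_norm (u + v) <= cspace_norm u + cspace_norm v.
Proof. exact: ler_normD. Qed.

Let cspace_normZ (a : R) (v : cspace V) :
  cspace_norm (a *: v) = `|a| * cspace_norm v.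
Proof. exact: normrZ. Qed.

Let cspace_norm0_eq0 (v : cspace V) : cspace_norm v = 0 -> v = 0.
Proof. by move=> /normr0_eq0 v0; apply: val_inj. Qed.

HB.instance Definition _ := Lmodule_isNormed.Build R (cspace V)
  cspace_normD cspace_normZ cspace_norm0_eq0.

End Norm.

(* The sum map is always continuous, so a continuous two-sided inverse makes it
   an isomorphism of topological vector spaces. *)
Definition topological_complement (V1 V2 : closedSubspace) : Prop :=
  let add (v : cspace V1 * cspace V2) := cspace_val v.1 + cspace_val v.2 in
  exists split : X -> cspace V1 * cspace V2,
    [/\ cancel add split, cancel split add & continuous split].

End ClosedSubspace.

Arguments closedSubspace {R} X.

Coercion cspace : closedSubspace >-> Sortclass.

Section ContinuousLinear.
Context {R : realType} (V W : normedModType R).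

Definition contlin_pred : {pred V -> W} :=
  [pred f : V -> W | `[< linear f /\ continuous f >]].

Lemma contlin_predP (f : V -> W) :
  reflect (linear f /\ continuous f) (f \in contlin_pred).
Proof. exact: asboolP. Qed.

Lemma contlin_submod : submod_closed contlin_pred.
Proof.
split.
  apply/contlin_predP; split=> [a u v|]; last exact: cst_continuous.
  by rewrite /= scaler0 addr0.
move=> a f g /contlin_predP[lf cf] /contlin_predP[lg cg].
apply/contlin_predP; split=> [b u v|x].
  rewrite !fctE lf lg !scalerDr !scalerA (mulrC b a) -!addrA; congr (_ + _).
  by rewrite addrCA.
apply: cvgD; last exact: cg.
by apply: cvgZr; exact: cf.
Qed.

HB.instance Definition _ :=
  GRing.isSubmodClosed.Build R (V -> W) contlin_pred contlin_submod.

Record contlin := Contlin {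
  contlin_fun :> V -> W;
  contlin_funP : contlin_fun \in contlin_pred }.

HB.instance Definition _ := [isSub for contlin_fun].
HB.instance Definition _ := [Choice of contlin by <:].
HB.instance Definition _ := [SubChoice_isSubLmodule of contlin by <:].

Definition opnorm (f : contlin) : R :=
  sup [set `|f v| | v in [set v : V | `|v| <= 1]].

Lemma contlin_linear (f : contlin) : linear f.
Proof. by case: f => f /= /contlin_predP[]. Qed.

Lemma contlin_continuous (f : contlin) : continuous f.
Proof. by case: f => f /= /contlin_predP[]. Qed.

Lemma opnorm_has_sup (f : contlin) :
  has_sup [set `|f v| | v in [set v : V | `|v| <= 1]].
Proof.
split; first by exists `|f 0|, 0 => //=; rewrite normr0.
pose g : {linear V -> W} :=
  HB.pack (f : V -> W) (GRing.isLinear.Build _ _ _ _ _ (contlin_linear f)).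
have /linear_boundedP[M [_ gM]] : bounded_near g (nbhs (0 : V)).
  apply: continuous_linear_bounded; exact: (@contlin_continuous f 0).
exists (`|M| + 1) => _ [v /= v1 <-].
have := gM (`|M| + 1) _ v; rewrite ltr_pwDr ?ler_norm// => /(_ isT) /le_trans.
by apply; rewrite ler_piMr// addr_ge0.
Qed.

Lemma opnorm_ub (f : contlin) (v : V) : `|v| <= 1 -> `|f v| <= opnorm f.
Proof.
move=> v1; apply: sup_upper_bound; first exact: opnorm_has_sup.
by exists v.
Qed.

Lemma opnorm_le (f : contlin) (M : R) :
  (forall v : V, `|v| <= 1 -> `|f v| <= M) -> opnorm f <= M.
Proof.
move=> fM; apply: ge_sup; first by case: (opnorm_has_sup f).
by move=> _ [v /= v1 <-]; exact: fM.
Qed.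

Lemma opnorm_ge0 (f : contlin) : 0 <= opnorm f.
Proof.
by apply: (le_trans (normr_ge0 (f 0))); apply: opnorm_ub; rewrite normr0.
Qed.

Let opnormD (f g : contlin) : opnorm (f + g) <= opnorm f + opnorm g.
Proof.
apply: opnorm_le => v v1; apply: (le_trans (ler_normD _ _)).
by apply: lerD; exact: opnorm_ub.
Qed.

Let opnormZ_le (a : R) (f : contlin) : opnorm (a *: f) <= `|a| * opnorm f.
Proof.
apply: opnorm_le => v v1.
rewrite [X in `|X|](_ : _ = a *: f v)// normrZ.
by apply: ler_wpM2l => //; exact: opnorm_ub.
Qed.

Let opnormZ (a : R) (f : contlin) : opnorm (a *: f) = `|a| * opnorm f.
Proof.
apply/eqP; rewrite eq_le opnormZ_le/=.
have [->|a0] := eqVneq a 0; first by rewrite normr0 mul0r opnorm_ge0.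
rewrite -ler_pdivlMl ?normr_gt0// -normfV.
by rewrite -[f in leLHS]scale1r -(mulVf a0) -scalerA opnormZ_le.
Qed.

Let opnorm0_eq0 (f : contlin) : opnorm f = 0 -> f = 0.
Proof.
move=> f0; apply: val_inj; apply/funext => v /=.
pose g : {linear V -> W} :=
  HB.pack (f : V -> W) (GRing.isLinear.Build _ _ _ _ _ (contlin_linear f)).
have [->|v0] := eqVneq v 0; first exact: (linear0 g).
have := @opnorm_ub f (`|v|^-1 *: v).
rewrite f0 normrZ normfV normr_id mulVf ?normr_eq0// => /(_ (lexx _)).
rewrite -[f _]/(g _) linearZ/= normr_le0 scaler_eq0 invr_eq0 normr_eq0.
by rewrite (negPf v0) => /eqP.
Qed.

HB.instance Definition _ := Lmodule_isNormed.Build R contlin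
  opnormD opnormZ opnorm0_eq0.

End ContinuousLinear.

Definition separable (T : topologicalType) : Prop :=
  exists2 D : set T, countable D & dense D.

Section Porous.
Context {R : realType} {X : normedModType R}.

Definition porous_at (A : set X) (x : X) : Prop :=
  exists2 c : R, 0 < c &
    forall d : R, 0 < d -> exists t : X,
      [/\ ball x d t, t != x & ball t (c * `|t - x|) `&` A = set0].

Definition porous (A : set X) : Prop := forall x, A x -> porous_at A x.

(* The empty set is porous, so indexing by nat also covers finite unions. *)
Definition sigma_porous (A : set X) : Prop :=
  exists2 F : nat -> set X, (forall n, porous (F n)) & A = \bigcup_n F n.

End Porous.

Section Local.
Context {R : realType} {X Y : normedModType R}.
Implicit Types (f : X -> Y) (x : X).

(* These notions depend only on the germ of [f] at [x]; a map defined on an open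
   set is represented by any total extension, and they are used only at points
   of that open set. *)
Definition lipschitz_at f x : Prop :=
  (limf_esup (fun y => (`|f y - f x| / `|y - x|)%:E) x^' < +oo)%E.

Definition differentiable_along f x (V : closedSubspace X) : Prop :=
  differentiable (fun v : V => f (x + cspace_val v)) 0.

End Local.

(* Main.v *)
From HB Require Import structures.
Require Import Defs.
From mathcomp Require Import all_boot all_order all_algebra.
From mathcomp Require Import all_classical all_reals all_analysis.
From mathcomp Require Import ring lra.

Import Order.TTheory GRing.Theory Num.Theory.
Import numFieldNormedType.Exports.

Local Open Scope classical_set_scope.
Local Open Scope ring_scope.

(* Fix [T] in a countable dense subset of L(V1, Y) and positive integers [k],
   [n]; let E be the set of points at which [f] has Lipschitz constant [n] and
   is approximated by [T] along V1 up to 1/k, both within radius 1/n.  The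
   exceptional set consists of the points of some E at which E is porous.
   Otherwise every [y] near [x] has a point [a] of E at distance at most
   [c * |y - x|].  Writing [a - x = p1 + p2] along V1 and V2, the plane [a + V1]
   meets [x + V2] exactly at [a - p1 = x + p2], so [f y - f x] is computed along
   y -> a (Lipschitz at [a]), a -> a - p1 (approximation by [T] at [a]) and
   x + p2 -> x (derivative along V2).  The sets E do not
   involve V2, which may therefore depend on [x]. *)

(** * Linear bounds and pointwise remainder estimates *)

Lemma continuous_linear_lipschitz (R : realType) (V W : normedModType R)
    (L : {linear V -> W}) :
  {for 0, continuous L} -> exists2 M : R, 0 < M & forall v, `|L v| <= M * `|v|.
Proof.
by move=> /(continuous_linear_bounded 0)/linear_boundedP/pinfty_ex_gt0.
Qed.

Lemma lipschitz_linear_continuous (R : realType) (V W : normedModType R)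
    (L : {linear V -> W}) (M : R) :
  (forall v, `|L v| <= M * `|v|) -> continuous L.
Proof.
move=> LM; apply: bounded_linear_continuous; apply/linear_boundedP.
near=> r => v; apply: (le_trans (LM v)); exact: ler_wpM2r.
Unshelve. all: by end_near. Qed.

Lemma differentiable_remainder (R : realType) (V W : normedModType R)
    (f : V -> W) (x : V) (e : R) :
  differentiable f x -> 0 < e ->
  exists2 d : R, 0 < d &
    forall v, `|v| < d -> `|f (x + v) - f x - 'd f x v| <= e * `|v|.
Proof.
move=> /diff_locally/eqaddoP df e0; have /nbhs_norm0P[d d0 fd] := df e e0.
exists d => // v /fd; rewrite !fctE/= [v + x]addrC.
by rewrite opprD addrA.
Qed.

(** The predicate [differentiable] refers to the chosen differential ['d f x]; uniqueness of the
    differential identifies it with [L]. *)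
Lemma differentiable_of_remainder (R : realType) (V W : normedModType R)
    (f : V -> W) (x : V) (L : {linear V -> W}) :
  continuous L ->
  (forall e : R, 0 < e -> exists2 d : R, 0 < d &
    forall v, `|v| < d -> `|f (x + v) - f x - L v| <= e * `|v|) ->
  differentiable f x.
Proof.
move=> cL fL.
have fLo : f \o shift x = cst (f x) + L +o_ 0 id.
  apply/eqaddoP => e e0; apply/nbhs_norm0P; have [d d0 fd] := fL e e0.
  exists d => // v /fd; rewrite !fctE/= [v + x]addrC.
  by rewrite opprD addrA.
by apply/diff_locallyP; rewrite (diff_unique cL fLo).
Qed.

(** The limsup is an infimum of suprema over punctured neighbourhoods. If it is below [+oo], so is
    one of these suprema, and that supremum serves as [M]. *)
Lemma lipschitz_at_bound (R : realType) (X Y : normedModType R)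
    (f : X -> Y) (x : X) :
  lipschitz_at f x ->
  exists M d : R, [/\ 0 < d &
    forall y, `|y - x| < d -> `|f y - f x| <= M * `|y - x|].
Proof.
move=> /ereal_inf_lt[_ [U /= + <-]] sU.
rewrite /dnbhs /within/= => /nbhs_normP[d /= d0 dU].
have [M fM] : exists M : R, forall y, `|y - x| < d -> y != x ->
    `|f y - f x| / `|y - x| <= M.
  have ubU y : `|y - x| < d -> y != x ->
      ((`|f y - f x| / `|y - x|)%:E <=
       ereal_sup [set (`|f y - f x| / `|y - x|)%:E | y in U])%E.
    move=> yd yx; apply: ereal_sup_ubound; exists y => //.
    by apply: dU => //=; rewrite distrC.
  case: (ereal_sup _) sU ubU => // [s _ ubU|_ ubU].
    by exists s => y yd /(ubU _ yd); rewrite lee_fin.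
  (* A supremum equal to [-oo] means that the punctured ball is empty, so any constant will do. *)
  by exists 0 => y yd /(ubU _ yd); rewrite leeNy_eq.
exists M, d; split=> // y yd.
have [->|yx] := eqVneq y x; first by rewrite !subrr !normr0 mulr0.
by rewrite -ler_pdivrMr ?normr_gt0 ?subr_eq0//; exact: fM.
Qed.

Lemma contlinZ (R : realType) (V W : normedModType R) (T : contlin V W)
    (b : R) (v : V) : T (b *: v) = b *: T v.
Proof.
have T0 : T 0 = 0.
  have := contlin_linear T (-1) 0 0.
  by rewrite scaleN1r oppr0 addr0 scaleN1r addNr.
by have := contlin_linear T b v 0; rewrite T0 !addr0.
Qed.

Lemma contlin_le_norm (R : realType) (V W : normedModType R)
    (T : contlin V W) (v : V) : `|T v| <= `|T| * `|v|.
Proof.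
have [->|v0] := eqVneq v 0.
  by rewrite -(scale0r 0) contlinZ !scale0r !normr0 mulr0.
have := @opnorm_ub _ _ _ T (`|v|^-1 *: v).
rewrite contlinZ !normrZ normfV normr_id mulVf ?normr_eq0// => /(_ (lexx _)).
by rewrite mulrC ler_pdivrMr ?normr_gt0.
Qed.

Lemma dense_normP (R : realType) (V : normedModType R) (D : set V) (v : V)
    (e : R) : dense D -> 0 < e -> exists2 u, D u & `|v - u| < e.
Proof.
move=> dD e0; have [|//|u [/= ve Du]] := dD (ball v e).
- by exists v; exact: ballxx.
- exact: ball_open.
- by exists u => //; rewrite -ball_normE in ve.
Qed.

Lemma ex_invS_lt (R : realType) (e : R) : 0 < e -> exists n, n.+1%:R^-1 < e.
Proof.
move=> e0; have [N _ Ne] := near_infty_natSinv_lt (PosNum e0).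
by exists N; apply: (Ne N) => /=.
Qed.

(** * Porosity and countable unions *)

Lemma porous_atS (R : realType) (X : normedModType R) (A B : set X) (x : X) :
  A `<=` B -> porous_at B x -> porous_at A x.
Proof.
move=> AB [c c0 Bx]; exists c => // d /Bx[t [xt tx Bt]]; exists t; split=> //.
by rewrite -subset0 -Bt; apply: setIS.
Qed.

Lemma porous_points (R : realType) (X : normedModType R) (A : set X) :
  porous [set x | A x /\ porous_at A x].
Proof. by move=> x [Ax]; apply: porous_atS => y []. Qed.

(** Countability gives an injection [g] of [D] into the naturals. Its fibre over [n] has at most one
    index, so the [n]-th set of the new family is empty or a single [F i]. *)
Lemma sigma_porous_bigcup (R : realType) (X : normedModType R) (I : Type)
    (D : set I) (F : I -> set X) :
  countable D -> (forall i, D i -> porous (F i)) ->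
  sigma_porous (\bigcup_(i in D) F i).
Proof.
move=> /countable_injP[g g_inj] pF.
exists (fun n => \bigcup_(i in D `&` g @^-1` [set n]) F i) => [n x|].
  move=> [i [Di gi] Fx]; apply: (@porous_atS _ _ _ (F i)); last exact: pF.
  move=> y [j [Dj gj] Fy]; suff -> : i = j by [].
  by apply: g_inj; rewrite ?inE// gi gj.
apply/seteqP; split=> [x [i Di Fx]|x [n _ [i [Di _] Fx]]]; last by exists i.
by exists (g i) => //; exists i.
Qed.

(** The map [split] inherits linearity from its inverse, the sum map. Its continuity at 0 then gives
    one constant for both components, as the product norm is a maximum. *)
Lemma complement_projections (R : realType) (X : normedModType R)
    (V1 V2 : closedSubspace X) :
  topological_complement V1 V2 ->
  exists (P1 : {linear X -> V1}) (P2 : {linear X -> V2}) (C : R),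
    [/\ 0 < C, forall z, z = cspace_val (P1 z) + cspace_val (P2 z),
        forall z, `|P1 z| <= C * `|z| & forall z, `|P2 z| <= C * `|z|].
Proof.
move=> [split [addK splitK split_cont]].
have split_lin : linear split.
  move=> a u v; apply: (can_inj addK); rewrite splitK /=.
  rewrite -[in LHS](splitK u) -[in LHS](splitK v) scalerDr.
  by rewrite addrACA.
have lin1 : linear (fst \o split) by move=> a u v; rewrite /= split_lin.
have lin2 : linear (snd \o split) by move=> a u v; rewrite /= split_lin.
pose S : {linear X -> (V1 * V2)%type} :=
  HB.pack split (GRing.isLinear.Build _ _ _ _ _ split_lin).
pose P1 : {linear X -> V1} :=
  HB.pack (fst \o split) (GRing.isLinear.Build _ _ _ _ _ lin1).
pose P2 : {linear X -> V2} :=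
  HB.pack (snd \o split) (GRing.isLinear.Build _ _ _ _ _ lin2).
have [C C0 SC] := continuous_linear_lipschitz _ _ _ S (split_cont 0).
exists P1, P2, C; split=> // z; first by rewrite -[LHS]splitK.
- by apply: le_trans (SC z); rewrite prod_normE le_max lexx.
- by apply: le_trans (SC z); rewrite prod_normE le_max lexx orbT.
Qed.

(** * Sets of uniform approximation along [V1] *)

Section UniformApproximation.
Context {R : realType} {X Y : normedModType R}.
Variables (f : X -> Y) (V1 : closedSubspace X).

Definition approx_set (T : contlin V1 Y) (k n : nat) : set X :=
  [set a |
    (forall y, `|y - a| <= n.+1%:R^-1 -> `|f y - f a| <= n.+1%:R * `|y - a|) /\
    (forall v : V1, `|v| <= n.+1%:R^-1 ->
      `|f (a + cspace_val v) - f a - T v| <= k.+1%:R^-1 * `|v|)].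

(** Half of the tolerance [k.+1%:R^-1] pays for replacing the derivative by [T], the other half for
    the remainder of [f]. *)
Lemma mem_approx_set (x : X) (T : contlin V1 Y) (k : nat) :
  lipschitz_at f x -> differentiable_along f x V1 ->
  (forall v, `|T v - 'd (fun v : V1 => f (x + cspace_val v)) 0 v| <=
     (2 * k.+1%:R)^-1 * `|v|) ->
  exists n, approx_set T k n x.
Proof.
move=> /lipschitz_at_bound[M [d [d0 fM]]] df TL.
have e0 : 0 < (2 * k.+1%:R)^-1 :> R by rewrite invr_gt0 mulr_gt0.
have [d' d'0 fd'] := differentiable_remainder _ _ _ _ _ _ df e0.
(* One [n] must bound both the radii and the Lipschitz constant. The sign of [M] is unknown, hence
   [|M| + 1]. *)
have m0 : 0 < Num.min (Num.min d d') (`|M| + 1)^-1.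
  by rewrite !lt_min d0 d'0 invr_gt0 ltr_wpDl.
have [n] := ex_invS_lt _ _ m0; rewrite !lt_min => /andP[/andP[nd nd'] nM].
exists n; split=> [y yn|v vn].
  apply: (le_trans (fM _ (le_lt_trans yn nd))); apply: ler_wpM2r => //.
  move: nM; rewrite ltf_pV2 ?posrE ?ltr_wpDl// => nM.
  by rewrite (le_trans (ler_norm M))// ltW// (lt_trans _ nM)// ltrDl.
have := fd' v (le_lt_trans vn nd'); rewrite add0r /= addr0 => fv.
rewrite -[_ - T v](subrKA ('d (fun v : V1 => f (x + cspace_val v)) 0 v)).
apply: (le_trans (ler_normD _ _)); rewrite [in leLHS]addrC.
have -> : k.+1%:R^-1 = (2 * k.+1%:R)^-1 + (2 * k.+1%:R)^-1 :> R.
  by field; rewrite nat1r pnatr_eq0.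
rewrite mulrDl; apply: lerD => //.
by rewrite distrC.
Qed.

(** If every radius [d] failed, the offending points [y] would be centres of holes witnessing
    porosity at [x] with constant [c]. *)
Lemma not_porous_at_dense (E : set X) (x : X) (c : R) :
  ~ porous_at E x -> 0 < c ->
  exists2 d : R, 0 < d & forall y, `|y - x| < d -> y != x ->
    exists2 a, E a & `|a - y| < c * `|y - x|.
Proof.
move=> nE c0; apply: contrapT => nd; apply: nE; exists c => // d d0.
apply: contrapT => nt; apply: nd; exists d => // y yd yx.
apply: contrapT => na; apply: nt; exists y; split => //.
  by rewrite -ball_normE /= distrC.
apply/seteqP; split=> // a [ya Ea]; apply: na; exists a => //.
by move: ya; rewrite -ball_normE /= distrC.
Qed.

Lemma approx_set_remainder (V2 : closedSubspace X) (P1 : {linear X -> V1})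
    (P2 : {linear X -> V2}) (C K e d : R) (L1 : V1 -> Y) (L2 : V2 -> Y)
    (L : {linear X -> Y}) (T : contlin V1 Y) (k n : nat) (x : X) :
  0 < C -> 0 < K -> 0 < e -> 0 < d ->
  (forall z, z = cspace_val (P1 z) + cspace_val (P2 z)) ->
  (forall z, `|P1 z| <= C * `|z|) -> (forall z, `|P2 z| <= C * `|z|) ->
  (forall z, L z = L1 (P1 z) + L2 (P2 z)) ->
  (forall z, `|L z| <= K * `|z|) ->
  k.+1%:R^-1 <= e / (12 * C) ->
  (forall v, `|T v - L1 v| <= k.+1%:R^-1 * `|v|) ->
  (forall v, `|v| < d ->
    `|f (x + cspace_val v) - f x - L2 v| <= e / (12 * C) * `|v|) ->
  ~ porous_at (approx_set T k n) x ->
  exists2 d' : R, 0 < d' & forall h, `|h| < d' ->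
    `|f (x + h) - f x - L h| <= e * `|h|.
Proof.
move=> C0 K0 e0 d0 PE P1C P2C LE LK kC TL1 fL2 nE.
pose N : R := n.+1%:R; have N0 : 0 < N by rewrite ltr0n.
pose r := N^-1; have r0 : 0 < r by rewrite invr_gt0.
(* The bound 1 keeps [a] within [2 * q] of [x], where [q] is the norm of [h]; the other bound makes
   the two errors proportional to [c * q] total at most [e / 2 * q]. *)
pose c := Num.min 1 (e / (2 * (N + K))).
have c0 : 0 < c by rewrite lt_min ltr01 divr_gt0 ?mulr_gt0 ?addr_gt0.
have c1 : c <= 1 by rewrite ge_min lexx.
have cNK : (N + K) * c <= e / 2.
  have : c <= e / (2 * (N + K)) by rewrite ge_min lexx orbT.
  rewrite ler_pdivlMr ?mulr_gt0 ?addr_gt0//; lra.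
have [d1 d10 dE] := not_porous_at_dense _ _ _ nE c0.
(* In order: a point [a] exists near [x + h]; [x + h] lies in the Lipschitz radius of [a]; [p1] lies
   in the radius where [T] approximates at [a]; [p2] lies in the radius of [fL2]. *)
exists (Num.min d1 (Num.min r (Num.min (r / (2 * C)) (d / (2 * C))))).
  by rewrite !lt_min d10 r0 !divr_gt0 ?mulr_gt0.
move=> h; rewrite !lt_min => /and4P[hd1 hr].
rewrite !ltr_pdivlMr ?mulr_gt0// => hC1 hC2.
have [->|h0] := eqVneq h 0.
  by rewrite addr0 subrr linear0 subr0 !normr0 mulr0.
have xhx : x + h - x = h by rewrite addrC addKr.
have [||a [fa Ta] ay] := dE (x + h); rewrite ?xhx//.
  by rewrite -subr_eq0 xhx.
rewrite xhx in ay.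
set q := `|h| in hd1 hr hC1 hC2 ay *; have q0 : 0 < q by rewrite normr_gt0.
have cq : c * q <= q by rewrite ler_piMl// ltW.
have fya : `|f (x + h) - f a| <= N * (c * q).
  rewrite (le_trans (fa _ _))// distrC; last by rewrite ler_wpM2l// ltW.
  by rewrite (le_trans (ltW ay))// (le_trans cq)// ltW.
have Lya : `|L (a - (x + h))| <= K * (c * q).
  by rewrite (le_trans (LK _))// ler_wpM2l// ltW.
have ax : `|a - x| <= 2 * q.
  rewrite -[a - x](subrKA (x + h)) (le_trans (ler_normD _ _))//.
  rewrite xhx -/q; lra.
set p1 := P1 (a - x); set p2 := P2 (a - x).
have Cax : C * `|a - x| <= 2 * C * q by rewrite mulrAC mulrC ler_wpM2r// ltW.
have p1C : `|p1| <= 2 * C * q by exact: le_trans (P1C _) Cax.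
have p2C : `|p2| <= 2 * C * q by exact: le_trans (P2C _) Cax.
have xp2 : x + cspace_val p2 = a + cspace_val (- p1).
  have := PE (a - x); rewrite -/p1 -/p2 => axE.
  rewrite -[LHS]/(x + cspace_val p2) -[RHS]/(a - cspace_val p1).
  by rewrite -[a in RHS](subrK x) axE addrAC [cspace_val p1 + _]addrC addrK addrC.
(* The approximation at [a] is used in the direction [- p1], which leads from [a] to [x + p2]. *)
have fp1 : `|f a - (f (x + cspace_val p2) + T p1)| <= e / (12 * C) * `|p1|.
  have := Ta (- p1); rewrite -xp2 normrN -(scaleN1r p1) contlinZ scaleN1r opprK.
  move=> fp1; rewrite distrC addrAC; apply: (le_trans (fp1 _)).
    by rewrite (le_trans p1C)// ltW// mulrC.
  by rewrite ler_wpM2r.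
have fp2 : `|f (x + cspace_val p2) + T p1 - (f x + L2 p2 + T p1)| <=
    e / (12 * C) * `|p2|.
  rewrite opprD addrACA subrr addr0 opprD addrA; apply: fL2.
  by rewrite (le_lt_trans p2C)// mulrC.
have Tp1 : `|f x + L2 p2 + T p1 - (f x + L (a - x))| <= e / (12 * C) * `|p1|.
  rewrite LE -/p1 -/p2 [L1 p1 + _]addrC addrA opprD addrACA subrr add0r.
  by rewrite (le_trans (TL1 _))// ler_wpM2r.
have Lah : `|f x + L (a - x) - (f x + L h)| <= K * (c * q).
  by rewrite opprD addrACA subrr add0r -linearB -addrA -opprD.
have eC : e / (12 * C) * (2 * C * q) = e * q / 6 by field; rewrite lt0r_neq0.
have [ep1 ep2] : e / (12 * C) * `|p1| <= e * q / 6 /\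
    e / (12 * C) * `|p2| <= e * q / 6.
  by rewrite -eC; split; apply: ler_wpM2l => //; rewrite divr_ge0 ?mulr_ge0 ?ltW.
have NKq : N * (c * q) + K * (c * q) <= e / 2 * q.
  by rewrite -mulrDl mulrA ler_wpM2r// ltW.
(* Four intermediate points give five errors: three of at most [e * q / 6], and two, [N * (c * q)]
   and [K * (c * q)], adding up to at most [e / 2 * q]. *)
rewrite -addrA -opprD.
apply: (le_trans (ler_distD (f a) _ _)).
apply: (le_trans (lerD fya (ler_distD (f (x + cspace_val p2) + T p1) _ _))).
apply: (le_trans (lerD (lexx _) (lerD fp1
  (ler_distD (f x + L2 p2 + T p1) _ _)))).
apply: (le_trans (lerD (lexx _) (lerD (lexx _) (lerD fp2
  (ler_distD (f x + L (a - x)) _ _))))).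
lra.
Qed.

End UniformApproximation.

Theorem proposition5p3 (R : realType) (X Y : completeNormedModType R)
    (X_nontrivial : exists x : X, x != 0)
    (Y_nontrivial : exists y : Y, y != 0)
    (G : set X) (f : X -> Y) (V1 : closedSubspace X) :
  open G ->
  separable (contlin V1 Y) ->
  exists A : set X,
    [/\ A `<=` G, sigma_porous A &
      forall x : X, (G `\` A) x ->
        lipschitz_at f x ->
        differentiable_along f x V1 ->
        (exists2 V2 : closedSubspace X,
          topological_complement V1 V2 & differentiable_along f x V2) ->
        differentiable f x].
Proof.
move=> _ [D Dcount Ddense].
(* Intersecting with [G] keeps the exceptional set inside [G]. *)
pose E (i : contlin V1 Y * (nat * nat)) : set X :=
  G `&` approx_set f V1 i.1 i.2.1 i.2.2.
exists (\bigcup_(i in D `*` setT) [set x | E i x /\ porous_at (E i) x]); split.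
- by move=> x [i _ [[Gx _] _]].
- apply: sigma_porous_bigcup; first exact: countableX.
  by move=> i _; exact: porous_points.
move=> x [Gx nAx] fx df1 [V2 /complement_projections].
move=> [P1 [P2 [C [C0 PE P1C P2C]]]] df2.
set L1 := 'd (fun v : V1 => f (x + cspace_val v)) 0.
set L2 := 'd (fun v : V2 => f (x + cspace_val v)) 0.
have L1c : continuous L1 by exact: diff_continuous df1.
have L2c : continuous L2 by exact: diff_continuous df2.
(* The two partial derivatives, composed with the projections, form the only candidate for the
   derivative at [x]. *)
have L_lin : linear (fun z => L1 (P1 z) + L2 (P2 z)).
  by move=> a u v; rewrite !linearP scalerDr addrACA.
pose L : {linear X -> Y} :=
  HB.pack (fun z => L1 (P1 z) + L2 (P2 z))
    (GRing.isLinear.Build _ _ _ _ _ L_lin).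
have [M1 M10 L1M] := continuous_linear_lipschitz _ _ _ _ (L1c 0).
have [M2 M20 L2M] := continuous_linear_lipschitz _ _ _ _ (L2c 0).
pose K := M1 * C + M2 * C.
have LK z : `|L z| <= K * `|z|.
  rewrite mulrDl -!mulrA (le_trans (ler_normD _ _))// lerD//.
    by rewrite (le_trans (L1M _))// ler_wpM2l// ltW.
  by rewrite (le_trans (L2M _))// ler_wpM2l// ltW.
apply: (differentiable_of_remainder _ _ _ _ _ L).
  exact: lipschitz_linear_continuous LK.
move=> e e0.
have eC0 : 0 < e / (12 * C) by rewrite divr_gt0 ?mulr_gt0.
have [k ke] := ex_invS_lt _ _ eC0.
have k0 : 0 < (2 * k.+1%:R)^-1 :> R by rewrite invr_gt0 mulr_gt0.
pose T1 : contlin V1 Y :=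
  Contlin (introT (contlin_predP L1) (conj (linearP L1) L1c)).
have [T DT T1T] := dense_normP _ _ _ T1 _ Ddense k0.
have TL1 v : `|T v - L1 v| <= (2 * k.+1%:R)^-1 * `|v|.
  rewrite distrC (le_trans (contlin_le_norm _ _ _ (T1 - T) v))//.
  by rewrite ler_wpM2r// ltW.
have [n Tx] := mem_approx_set _ _ _ _ _ fx df1 TL1.
have [d d0 fd] := differentiable_remainder _ _ _ _ _ _ df2 eC0.
apply: (@approx_set_remainder _ _ _ f V1 V2 P1 P2 C K e d L1 L2 L T k n x) => //.
- by rewrite addr_gt0// mulr_gt0.
- exact: ltW.
- move=> v; apply: (le_trans (TL1 v)); rewrite ler_wpM2r//.
  by rewrite invfM ler_piMl// invf_le1// ler1n.
- by move=> v /fd; rewrite add0r /= addr0.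
(* Since [x] lies in [E (T, (k, n))], porosity of the larger [approx_set] at [x] would pass to this
   subset and put [x] in the exceptional set. *)
- move=> px; apply: nAx; exists (T, (k, n)) => //; split=> //.
  by apply: porous_atS px => y [].
Qed.
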